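(* Let $T$ be an infinite Hausdorff topological space whose isolated points form a dense subset of $T$. Let $X$ be a closed subspace of $C_b(T)$ such that $X$ contains the characteristic function $\mathbf 1_{\{t\}}$ for each isolated point $t\in T$. Then the Banach space $X$ has no countable star-finite covering by closed balls.
   Context: $C_b(T)$ is the real Banach space of all bounded continuous real-valued functions on $T$ with the supremum norm $\|x\|_\infty=\sup_{t\in T}|x(t)|$. Closed balls are balls of $X$ of positive radius. A covering of $X$ is a family of nonempty subsets of $X$ whose union is $X$. A family of sets is star-finite if each of its members intersects only finitely many other members. *)

(* Defs.v *)
From HB Require Import structures.
From mathcomp Require Import all_boot all_order all_algebra.
From mathcomp Require Import all_classical all_reals all_analysis.
From mathcomp Require Import ring lra.

Set Implicit Arguments.
Unset Strict Implicit.
Unset Printing Implicit Defensive.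

Import Order.TTheory GRing.Theory Num.Theory.
Import numFieldNormedType.Exports.

Local Open Scope classical_set_scope.
Local Open Scope ring_scope.

Section BoundedContinuous.
Context (T : topologicalType) (R : realType).

Definition Cb_pred : {pred T -> R} :=
  mem [set f : T -> R | continuous f /\ [bounded f t | t in [set: T]]].

Record Cb := MkCb { Cb_fun :> T -> R ; Cb_funP : Cb_fun \in Cb_pred }.

HB.instance Definition _ := [isSub for Cb_fun].
HB.instance Definition _ := [Choice of Cb by <:].

Lemma Cb_continuous (f : Cb) : continuous f.
Proof. by have /set_mem[] := Cb_funP f. Qed.

Lemma Cb_bounded (f : Cb) : [bounded f t | t in [set: T]].
Proof. by have /set_mem[] := Cb_funP f. Qed.

Lemma Cb_submod_closed : submod_closed Cb_pred.
Proof.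
split.
  apply/mem_set; split; first exact: cst_continuous.
  by exists 0; split=> // M M0 t _; rewrite /= normr0 ltW.
move=> a f g /set_mem[cf [M [Mr bf]]] /set_mem[cg [N [Nr bg]]].
apply/mem_set; split.
  move=> t; apply: cvgD; last exact: cg.
  by apply: cvgM; [exact: cvg_cst|exact: cf].
exists (`|a| * (`|M| + 1) + (`|N| + 1)); split; first exact: num_real.
move=> K hK t _; apply/ltW/le_lt_trans/hK => /=.
apply: (le_trans (ler_normD _ _)); apply: lerD; last first.
  by apply: bg => //; rewrite (le_lt_trans (ler_norm _))// ltrDl.
rewrite normrM ler_wpM2l//.
by apply: bf => //; rewrite (le_lt_trans (ler_norm _))// ltrDl.
Qed.

HB.instance Definition _ :=
  GRing.isSubmodClosed.Build _ _ Cb_pred Cb_submod_closed.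
HB.instance Definition _ := [SubChoice_isSubLmodule of Cb by <:].

(* When T is empty, [sup set0 = 0] is still the right value. *)
Definition Cb_norm (f : Cb) : R := sup (range (fun t => `|f t|)).

Lemma Cb_norm_ubound (f : Cb) : has_ubound (range (fun t => `|f t|)).
Proof.
have [M [Mr bf]] := Cb_bounded f.
by exists (M + 1) => _ [t _ <-]; apply: bf => //; rewrite ltrDl.
Qed.

Lemma Cb_norm_ge (f : Cb) t : `|f t| <= Cb_norm f.
Proof. by apply: ub_le_sup; [exact: Cb_norm_ubound|exists t]. Qed.

Lemma Cb_norm_ge0 (f : Cb) : 0 <= Cb_norm f.
Proof.
have [[_ [t _ _]]|/nonemptyPn ne] := pselect (range (fun t => `|f t|) !=set0).
  exact: le_trans (normr_ge0 (f t)) (Cb_norm_ge f t).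
by rewrite /Cb_norm ne sup0.
Qed.

Lemma Cb_norm_le (f : Cb) (M : R) :
  0 <= M -> (forall t, `|f t| <= M) -> Cb_norm f <= M.
Proof.
move=> M0 fM; rewrite /Cb_norm.
have [->|ne] := eqVneq (range (fun t => `|f t|)) set0; first by rewrite sup0.
by apply: ge_sup; [exact/set0P|move=> _ [t _ <-]].
Qed.

Lemma Cb_normD (f g : Cb) : Cb_norm (f + g) <= Cb_norm f + Cb_norm g.
Proof.
apply: Cb_norm_le => [|t]; first by rewrite addr_ge0// Cb_norm_ge0.
by rewrite (le_trans (ler_normD _ _))// lerD// Cb_norm_ge.
Qed.

Lemma Cb_normZ (a : R) (f : Cb) : Cb_norm (a *: f) = `|a| * Cb_norm f.
Proof.
have le (b : R) (g : Cb) : Cb_norm (b *: g) <= `|b| * Cb_norm g.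
  apply: Cb_norm_le => [|t]; first by rewrite mulr_ge0// Cb_norm_ge0.
  by rewrite normrM ler_wpM2l// Cb_norm_ge.
apply/le_anti; rewrite le/=.
have [->|a0] := eqVneq a 0; first by rewrite normr0 mul0r Cb_norm_ge0.
rewrite -ler_pdivlMl ?normr_gt0// -normfV.
by rewrite -[f in leLHS](scalerK a0) le.
Qed.

Lemma Cb_norm0_eq0 (f : Cb) : Cb_norm f = 0 -> f = 0.
Proof.
move=> f0; apply/val_inj/funext => t /=.
by apply/normr0_eq0/le_anti; rewrite -{1}f0 Cb_norm_ge normr_ge0.
Qed.

HB.instance Definition _ :=
  Lmodule_isNormed.Build R Cb Cb_normD Cb_normZ Cb_norm0_eq0.

Lemma Cb_normE (f : Cb) : `|f| = sup (range (fun t => `|f t|)).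
Proof. by []. Qed.

Lemma Cb_complete (F : set_system Cb) : ProperFilter F -> cauchy F -> cvg F.
Proof.
move=> FF /cauchyP Fc.
pose l t := lim ((fun f : Cb => f t) @ F).
have near_g (e : R) : 0 < e ->
    exists2 g : Cb, (\forall f \near F, `|g - f| < e) &
                    forall t, `|g t - l t| <= e.
  move=> e0; have [g gF] := Fc _ e0.
  have gF' : \forall f \near F, `|g - f| < e by apply: filterS gF => f; rewrite -ball_normE.
  exists g => // t.
  have cl : (fun f : Cb => f t) @ F --> l t.
    apply: R_complete; apply/cauchyP => d d0.
    have [h hF] := Fc _ d0; exists (h t); apply: (@filterS _ F _ (ball h d)) hF => f.
    rewrite -!ball_normE /= => hf.
    exact: le_lt_trans (Cb_norm_ge (h - f) t) hf.
  have cn : (fun f : Cb => `|g t - f t|) @ F --> `|g t - l t|.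
    by apply: cvg_norm; apply: cvgB => //; exact: cvg_cst.
  apply: (cvgr_to_le cn).
  apply: filterS gF' => f gf.
  exact: le_trans (Cb_norm_ge (g - f) t) (ltW gf).
have lP : l \in Cb_pred.
  apply/mem_set; split.
    move=> t; apply/cvgrPdist_le => e e0.
    have e3 : 0 < e / 3 by rewrite divr_gt0.
    have [g _ gl] := near_g _ e3.
    have /cvgrPdist_le/(_ _ e3) := @Cb_continuous g t.
    apply: filterS => s gs.
    have -> : l t - l s = - (g t - l t) + (g t - g s) + (g s - l s) by ring.
    have -> : e = e / 3 + e / 3 + e / 3 by field.
    rewrite (le_trans (ler_normD _ _))// lerD//.
    by rewrite (le_trans (ler_normD _ _))// lerD// normrN.
  have [g _ gl] := near_g 1 ltr01.
  have [M [_ bg]] := Cb_bounded g.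
  exists (`|M| + 2); split; first exact: num_real.
  move=> K hK t _ /=.
  have -> : l t = g t - (g t - l t) by ring.
  have -> : K = (K - 1) + 1 by ring.
  rewrite (le_trans (ler_normB _ _))// lerD//.
  by apply: bg => //; have := ler_norm M; lra.
apply/cvg_ex; exists (MkCb lP); apply/cvgrPdist_le => e e0.
have [g gF gl] := near_g _ (divr_gt0 e0 (ltr0n R 2)).
apply: filterS gF => f gf.
apply: Cb_norm_le => [|t]; first exact: ltW.
change (`|l t - f t| <= e).
have -> : l t - f t = - (g t - l t) + (g t - f t) by ring.
have -> : e = e / 2 + e / 2 by field.
rewrite (le_trans (ler_normD _ _))// lerD// ?normrN//.
exact: le_trans (Cb_norm_ge (g - f) t) (ltW gf).
Qed.

HB.instance Definition _ := Uniform_isComplete.Build Cb Cb_complete.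

End BoundedContinuous.

Section Coverings.
Context {R : realType} {V : normedModType R}.
Implicit Types (X : set V) (F : set (set V)).

(* Balls of the normed space X itself: the centre lies in X and only points of
   X are taken. *)
Definition closed_balls X : set (set V) :=
  [set B | exists c r,
    [/\ X c, 0 < r & B = closed_ball_ (fun x : V => `|x|) c r `&` X]].

(* Families of sets are sets of sets. An indexed family that is star-finite,
   countable or covering has a range with the same property, so ruling out
   coverings of this form rules out the indexed ones as well. *)
Definition covering X F :=
  (forall B, F B -> B !=set0) /\ \bigcup_(B in F) B = X.

Definition star_finite F :=
  forall B, F B -> finite_set [set C | [/\ F C, C <> B & B `&` C !=set0]].

End Coverings.

(* Main.v *)
Require Import Defs.
From mathcomp Require Import all_boot all_order all_algebra.
From mathcomp Require Import all_classical all_reals all_analysis.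
From mathcomp Require Import ring lra.
Import Order.TTheory GRing.Theory Num.Theory.
Import numFieldNormedType.Exports.
Local Open Scope classical_set_scope.
Local Open Scope ring_scope.

(** In the supremum norm a ball is a box: since isolated points are dense, it is
    cut out by the conditions coord p y <= hi B p, where coord p is plus or minus
    the evaluation at an isolated point.  Two disjoint balls are therefore
    separated by one such signed coordinate ([disjoint_balls_separated]), and the
    characteristic functions allow a point of X to be moved along one coordinate
    without disturbing the others.

    Suppose a countable star-finite covering by balls exists.  Call a point of X
    singular if the balls through it do not cover a neighbourhood of it in X;
    equivalently, infinitely many balls come arbitrarily close to it.  Singular
    points are easy to make ([singular_shift]): raise y along a coordinate p until
    it leaves the last of the balls through y.  Only the finitely many balls that
    meet a ball through y could catch it there, and those that miss y are violated
    at finitely many isolated points, so for p away from these nothing catches it.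

    The singular points form a nonempty closed set, which by Baire's argument has
    a nonempty relatively open part contained in a single ball.  Choose x in that
    part with as few balls through it as possible.  Then every singular point
    near x lies in all balls through x.  Four consequences lead to a
    contradiction.
    - Near x, a point outside some ball through x is not close to the upper edge,
      along almost every coordinate, of all the balls containing it: otherwise
      raising it would produce a singular point near x in a wrong place
      ([exists_far_hi]).  So points near x in no ball through x lie in balls
      whose radius is bounded below ([exists_big_ball]).
    - Each ball B through x has its upper edge within any a > 0 of x along
      infinitely many coordinates ([exists_near_hi]): the big balls accumulating
      at x are separated from B, and if finitely many coordinates sufficed for
      that, pushing these balls across x along such a coordinate would produce a
      singular point outside B.
    - Along any coordinate where the upper edge of B is that close, another ball
      through x reaches higher ([exists_higher_ball]); otherwise the big balls
      covering points just beyond the edge would all contain one common point.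
    - Finally take y near x, in some ball B through x, with as few balls
      through y as possible.  By the previous facts y can be raised along some
      coordinate out of B while staying near x and inside another ball through y.
      It then lies in fewer balls ([no_minimal_singular_point]). *)

(** * Finite families and a Baire argument *)

Lemma finite_uniform_pos (R : realType) (I : choiceType) (A : set I)
    (P : I -> R -> Prop) :
  finite_set A -> (forall i, A i -> exists2 d, 0 < d & P i d) ->
  (forall i d d', d' <= d -> P i d -> P i d') ->
  exists2 d, 0 < d & forall i, A i -> P i d.
Proof.
move=> /finite_seqP[s ->] + Pmono; elim: s => [|i s IHs] Ps.
  by exists 1.
have [d d0 Pd] : exists2 d, 0 < d & forall j, j \in s -> P j d.
  by apply: IHs => j js; apply: Ps; rewrite /= inE js orbT.
have [d' d'0 Pd'] := Ps i (mem_head i s).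
exists (Order.min d d') => [|j]; first by rewrite lt_min d0.
rewrite /= inE => /predU1P[->|js].
  by apply: Pmono Pd'; rewrite ge_min lexx orbT.
by apply: Pmono (Pd _ js); rewrite ge_min lexx.
Qed.

Lemma exists_max_finite (R : realType) (I : choiceType) (A : set I)
    (f : I -> R) :
  finite_set A -> A !=set0 ->
  exists2 i, A i & forall j, A j -> f j <= f i.
Proof.
move=> /finite_seqP[s ->] [+ +]; elim: s => // i s IHs i0 _.
have [js|sN] := pselect (exists j, j \in s); last first.
  exists i => [|j /=]; first exact: mem_head.
  by rewrite inE => /predU1P[->//|js]; case: sN; exists j.
case: js => j /IHs[k /= ks kmax]; have [fik|fki] := leP (f i) (f k).
  exists k => [|l /=]; first by rewrite /= inE ks orbT.
  by rewrite inE => /predU1P[->//|]; exact: kmax.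
exists i => [|l /=]; first exact: mem_head.
by rewrite inE => /predU1P[->//|/kmax fl]; exact: le_trans (ltW fki).
Qed.

(** A chain of strict inclusions N v < N u ends because cardinals decrease. *)
Lemma exists_min_finite (U : Type) (W : choiceType) (Y : set U)
    (N : U -> set W) :
  Y !=set0 -> (forall u, finite_set (N u)) ->
  exists2 u, Y u & forall v, Y v -> N v `<=` N u -> N u `<=` N v.
Proof.
move=> [u0 Yu0] finN; pose size_N u := finmap.enum_fset (fset_set (N u)).
have [n] := ubnP (size (size_N u0)).
elim: n => // n IHn in u0 Yu0 *; rewrite ltnS => ltn.
have [umin|] := pselect (forall v, Y v -> N v `<=` N u0 -> N u0 `<=` N v).
  by exists u0.
move=> /existsNP[v] /not_implyP[Yv] /not_implyP[Nvu Nuv].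
apply: (IHn v) => //; apply: leq_trans ltn.
apply: finmap.fproper_ltn_card; rewrite finmap.fproperE.
apply/andP; split; first by rewrite -fset_set_sub.
by apply/negP; rewrite -fset_set_sub.
Qed.

(** The Baire category theorem on the closed set D, in the form of a ball of D
    swallowed by one member of the countable cover.  If there were none, nested
    balls centred in D could avoid the members of F one after the other, and
    their centres would converge to a point of D that is not covered. *)
Lemma closed_baire (R : realType) (V : completeNormedModType R)
    (D : set V) (F : set (set V)) :
  closed D -> D !=set0 -> countable F -> (forall B, F B -> closed B) ->
  D `<=` \bigcup_(B in F) B ->
  exists B x e, [/\ F B, D x, 0 < e &
    forall y, D y -> `|y - x| < e -> B y].
Proof.
move=> clD [x0 Dx0] /countable_injP[g ginj] clF DF; apply: contrapT => nB.
pose good (a : V * R) := D a.1 /\ 0 < a.2.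
pose next n (a b : V * R) := [/\ good b, b.2 <= a.2 / 2,
  `|b.1 - a.1| + b.2 <= a.2 &
  forall B, F B -> g B = n -> forall y, `|y - b.1| <= b.2 -> ~ B y].
(* When no member of F has number n, the n-th step only halves the radius; the
   junk value outside good makes the choice function total. *)
have ex_next na : exists b, good na.2 -> next na.1 na.2 b.
  case: na => n [x e]; have [[Dx e0]|] := pselect (good (x, e)); last first.
    by exists (x, e).
  have [[B [FB gB]]|nF] := pselect (exists B, F B /\ g B = n); last first.
    exists (x, e / 2) => _; split => //=.
    - by split=> //; rewrite divr_gt0.
    - by rewrite subrr normr0 add0r; move: e0 => /=; lra.
    - by move=> B FB gB; case: nF; exists B.
  have [y [Dy yx nBy]] : exists y, [/\ D y, `|y - x| < e & ~ B y].
    apply: contrapT => nBy; apply: nB; exists B, x, e; split => // y Dy yx.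
    by apply: contrapT => ?; apply: nBy; exists y.
  have /nbhs_ballP[d /= d0 dB] : nbhs y (~` B).
    by apply: open_nbhs_nbhs; split=> //; apply: closed_openC; exact: clF.
  pose m := Order.min (d / 2) (Order.min (e / 2) (e - `|y - x|)).
  exists (y, m) => _; split => /=.
  - by split=> //=; rewrite !lt_min !divr_gt0//= subr_gt0.
  - by rewrite /m !ge_min lexx !orbT.
  - have : m <= e - `|y - x| by rewrite /m !ge_min lexx !orbT.
    lra.
  - move=> C FC gC z zy.
    have -> : C = B by apply: ginj; rewrite ?inE// gC.
    apply: dB; rewrite -ball_normE /= distrC (le_lt_trans zy)//.
    by rewrite gt_min ltr_pdivrMr// mulr2n mulrDr mulr1 ltrDl d0.
have [f fP] := choice ex_next.
have [e0 e0_gt0] : exists e : R, 0 < e by exists 1.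
pose fix u n := if n is k.+1 then f (k, u k) else (x0, e0).
have ugood n : good (u n).
  by elim: n => // n IHn; have [] := fP (n, u n) IHn.
have unext n : next n (u n) (u n.+1) by exact: fP (n, u n) (ugood n).
have nested m n : (n <= m)%N -> `|(u m).1 - (u n).1| + (u m).2 <= (u n).2.
  elim: m => [|m IHm]; first by rewrite leqn0 => /eqP ->; rewrite subrr normr0 add0r.
  rewrite leq_eqVlt => /predU1P[->|]; first by rewrite subrr normr0 add0r.
  rewrite ltnS => /IHm um; have [_ _ um1 _] := unext m.
  have := ler_normD ((u m.+1).1 - (u m).1) ((u m).1 - (u n).1).
  by rewrite addrA subrK; lra.
have r_le n : (u n).2 <= e0 / 2 ^+ n.
  elim: n => [|n IHn]; first by rewrite expr0 divr1.
  have [_ un1 _ _] := unext n; apply: (le_trans un1).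
  by rewrite exprSr invfM mulrA ler_pM2r// invr_gt0.
pose a n := (u n).1.
have r0 : (fun n => e0 / 2 ^+ n) @ \oo --> (0 : R).
  have -> : (fun n => e0 / 2 ^+ n) = geometric e0 (2^-1).
    by apply/funext => n; rewrite /geometric /= exprVn.
  by apply: cvg_geometric; rewrite gtr0_norm// invf_lt1// ltr1n.
have small (d : R) : 0 < d -> exists n, (u n).2 < d.
  move=> d0; move/cvgr0_norm_lt: r0 => /(_ d d0)[n _ /(_ n (leqnn n))] /= h.
  exists n; apply: le_lt_trans h; apply: le_trans (ler_norm _); exact: r_le.
have /cvg_ex[l al] : cvg (a @ \oo).
  apply: cauchy_cvg; apply: cauchy_exP => d d0.
  have [n un] := small d d0; exists (a n), n => // m /= nm.
  rewrite -ball_normE /= distrC (le_lt_trans _ un)//.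
  have [_ um0] := ugood m; have := nested m n nm.
  by rewrite /a; lra.
have al_le n : `|l - a n| <= (u n).2.
  have cl : (fun m => `|a m - a n|) @ \oo --> `|l - a n|.
    by apply: cvg_norm; apply: cvgB => //; exact: cvg_cst.
  apply: (cvgr_to_le cl); exists n => // m /= nm.
  by have [_ um0] := ugood m; have := nested m n nm; rewrite /a; lra.
have Dl : D l.
  by apply: (closed_cvg D) al => //; exists 0%N => // n _; have [] := ugood n.
have [B FB Bl] := DF l Dl.
by have [_ _ _ /(_ B FB erefl l)] := unext (g B); apply => //; exact: al_le.
Qed.

(** * Signed coordinates *)

Section SignedCoordinates.
Local Set Implicit Arguments.
Local Unset Strict Implicit.
Context (R : realType) (T : topologicalType).
Implicit Types (p q : T * bool) (y z : Cb T R).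

(** Carrying the sign with the point makes the two faces of a box at a
    coordinate two instances of the same notion. *)
Definition coord p y : R := (-1) ^+ p.2 * y p.1.

Definition flip p := (p.1, ~~ p.2).

Lemma coordD p y z : coord p (y + z) = coord p y + coord p z.
Proof. exact: mulrDr. Qed.

Lemma coordN p y : coord p (- y) = - coord p y.
Proof. exact: mulrN. Qed.

Lemma coordZ p a y : coord p (a *: y) = a * coord p y.
Proof. exact: mulrCA. Qed.

Lemma coord_flip p y : coord (flip p) y = - coord p y.
Proof. by rewrite /coord /= signrN mulNr. Qed.

Lemma normr_coord p y : `|coord p y| = `|y p.1|.
Proof. by rewrite normrM normr_sign mul1r. Qed.

Lemma coord_le_norm p y : coord p y <= `|y|.
Proof.
by rewrite (le_trans (ler_norm _))// normr_coord; exact: Cb_norm_ge.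
Qed.

Lemma norm_le_coord (M : R) y : dense (isolated [set: T]) -> 0 <= M ->
  (forall p, isolated [set: T] p.1 -> coord p y <= M) -> `|y| <= M.
Proof.
move=> iso_dense M0 yM; apply: Cb_norm_le => // t.
rewrite leNgt; apply/negP => ty.
pose O := (fun s => `|y s|) @^-1` [set a | M < a].
have oO : open O.
  apply: open_comp; last exact: open_gt.
  move=> s _.
  by apply: (continuous_comp (@Cb_continuous _ _ y s)); exact: norm_continuous.
have O0 : O !=set0 by exists t.
have [s [sO siso]] := iso_dense O O0 oO.
(* The sign is the one that turns the value at s into its absolute value. *)
have := yM (s, y s < 0) siso; rewrite /coord /= -normrEsign.
by move: sO; rewrite /O /=; rewrite leNgt => ->.
Qed.

End SignedCoordinates.

(** * Balls as boxes *)

Section StarFiniteCovering.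
Local Set Implicit Arguments.
Local Unset Strict Implicit.
Context (R : realType) (T : topologicalType).
Local Notation V := (Cb T R).
Local Notation iso := (isolated [set: T]).
Context (iso_infinite : infinite_set iso) (iso_dense : dense iso).
Context (X : set V) (X_closed : closed X) (X0 : X 0)
  (X_lin : forall a y z, X y -> X z -> X (a *: y + z)).
Context (e : T -> V)
  (eP : forall t, iso t -> X (e t) /\ (e t : T -> R) = \1_[set t]).
Context (F : set (set V)) (c : set V -> V) (r : set V -> R)
  (ballF : forall B, F B -> [/\ X (c B), 0 < r B &
     B = closed_ball_ (fun y : V => `|y|) (c B) (r B) `&` X])
  (coverF : forall y, X y -> exists2 B, F B & B y)
  (meetF : forall B, F B -> finite_set [set C | F C /\ B `&` C !=set0]).
Implicit Types (p q : T * bool) (y z : V) (B C : set V).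

Definition hi B p := coord p (c B) + r B.
Definition lo B p := coord p (c B) - r B.

Lemma lo_flip B p : lo B p = - hi B (flip p).
Proof. by rewrite /lo /hi coord_flip; ring. Qed.

Lemma ballE B y : F B -> B y <-> `|y - c B| <= r B /\ X y.
Proof.
move=> /ballF[_ _ BE]; rewrite distrC; split; first by rewrite {1}BE.
by move=> yB; rewrite BE.
Qed.

Lemma ball_sub B y : F B -> B y -> X y.
Proof. by move=> FB /(ballE _ FB)[]. Qed.

Lemma ball_hiP B y : F B -> X y ->
  (forall p, iso p.1 -> coord p y <= hi B p) -> B y.
Proof.
move=> FB Xy yhi; have [_ r0 _] := ballF FB; apply/ballE => //; split => //.
apply: norm_le_coord => //; first exact: ltW.
by move=> p /yhi; rewrite /hi coordD coordN; lra.
Qed.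

Lemma ball_le_hi B y p : F B -> B y -> coord p y <= hi B p.
Proof.
move=> FB /(ballE _ FB)[yB _]; have := le_trans (coord_le_norm p _) yB.
by rewrite coordD coordN /hi; lra.
Qed.

Lemma ball_ge_lo B y p : F B -> B y -> lo B p <= coord p y.
Proof.
move=> FB /(ball_le_hi (flip p) FB).
by rewrite lo_flip coord_flip; lra.
Qed.

(** Otherwise the distance of the centres is at most the sum of the radii, and
    the point that divides the segment between them in the ratio of the radii
    lies in both balls. *)
Lemma disjoint_balls_separated B C : F B -> F C -> ~ (B `&` C !=set0) ->
  exists2 p, iso p.1 & hi B p < lo C p.
Proof.
move=> FB FC BC; apply: contrapT => nsep; apply: BC.
have [Xb rb0 _] := ballF FB; have [Xc rc0 _] := ballF FC.
have bc : `|c C - c B| <= r B + r C.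
  apply: norm_le_coord => //; first by rewrite addr_ge0 ?ltW.
  move=> p isop; rewrite coordD coordN.
  have : ~ hi B p < lo C p by move=> ?; apply: nsep; exists p.
  by rewrite /hi /lo => /negP; rewrite -leNgt; lra.
have s0 : 0 < r B + r C by rewrite addr_gt0.
pose a := r B / (r B + r C).
have a0 : 0 <= a by rewrite divr_ge0// ltW.
have a1E : 1 - a = r C / (r B + r C) by rewrite /a; field; rewrite gt_eqF.
have a1 : 0 <= 1 - a by rewrite a1E divr_ge0// ltW.
pose y := a *: (c C - c B) + c B.
have Xy : X y.
  apply: (X_lin _ _ Xb); rewrite addrC -scaleN1r; exact: X_lin.
exists y; split.
- apply/ballE => //; split => //; rewrite /y addrK normrZ.
  by rewrite ger0_norm// /a mulrAC ler_pdivrMr// ler_pM2l.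
- apply/ballE => //; split => //; rewrite distrC.
  have -> : c C - y = (1 - a) *: (c C - c B).
    by rewrite /y scalerBl scale1r opprD addrA addrAC.
  by rewrite normrZ ger0_norm// a1E mulrAC ler_pdivrMr// ler_pM2l.
Qed.

Lemma ball_closed B : F B -> closed B.
Proof.
by move=> /ballF[_ _ ->]; apply: closedI => //; exact: closed_closed_ball_.
Qed.

Lemma finite_balls_far (N : set (set V)) y : finite_set N -> N `<=` F ->
  exists2 d, 0 < d & forall B, N B -> ~ B y ->
    forall z, B z -> d <= `|z - y|.
Proof.
move=> finN NF.
apply: (@finite_uniform_pos R _ N (fun B d => ~ B y ->
    forall z, B z -> d <= `|z - y|)) => // [B NB|B d d' d'd Bd nBy z Bz].
  have [By|nBy] := pselect (B y); first by exists 1.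
  have /nbhs_ballP[d /= d0 dB] : nbhs y (~` B).
    apply: open_nbhs_nbhs; split => //; apply: closed_openC.
    exact: ball_closed (NF _ NB).
  exists d => // _ z Bz; rewrite leNgt; apply/negP => zy.
  by apply: (dB z) => //; rewrite -ball_normE /= distrC.
exact: le_trans d'd (Bd nBy z Bz).
Qed.

Definition balls_at y := [set B | F B /\ B y].

Lemma finite_balls_at y : finite_set (balls_at y).
Proof.
have [Xy|nXy] := pselect (X y).
  have [B FB By] := coverF Xy.
  by apply: sub_finite_set (meetF FB) => C [FC Cy]; split => //; exists y.
suff -> : balls_at y = set0 by exact: finite_set0.
by apply/seteqP; split => // B [FB /(ball_sub FB)].
Qed.

Definition shift p (s : R) y : V := y + ((-1) ^+ p.2 * s) *: e p.1.

Lemma shift_in p s y : iso p.1 -> X y -> X (shift p s y).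
Proof. by move=> /eP[Xe _] Xy; rewrite /shift addrC; exact: X_lin. Qed.

Lemma coord_shift p s y : iso p.1 -> coord p (shift p s y) = coord p y + s.
Proof.
move=> /eP[_ eE]; rewrite coordD coordZ /coord eE indicE mem_set//.
by rewrite mulr1 mulrAC -expr2 sqrr_sign mul1r.
Qed.

Lemma coord_shift_other p q s y : iso p.1 -> q.1 <> p.1 ->
  coord q (shift p s y) = coord q y.
Proof.
move=> /eP[_ eE] qp; rewrite coordD coordZ /coord eE indicE memNset//.
by rewrite !mulr0 addr0.
Qed.

(** Raising along p lowers the opposite coordinate flip p and fixes all others,
    so it can leave a ball only through the face hi B p. *)
Lemma coord_shift_le p q s y : iso p.1 -> 0 <= s -> q <> p ->
  coord q (shift p s y) <= coord q y.
Proof.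
move=> isop s0 qp; have [q1|/eqP q1] := eqVneq q.1 p.1; last first.
  by rewrite coord_shift_other.
have -> : q = flip p.
  case: p q q1 qp {isop} => [t b] [t' b'] /= -> bb; rewrite /flip /=.
  by case: b b' bb => [] [].
by rewrite !coord_flip coord_shift//; lra.
Qed.

Lemma shiftD p s s' y : shift p s (shift p s' y) = shift p (s' + s) y.
Proof. by rewrite /shift -addrA -scalerDl mulrDr. Qed.

Lemma norm_shift_sub p s y : iso p.1 -> `|shift p s y - y| <= `|s|.
Proof.
move=> isop; rewrite /shift addrAC subrr add0r normrZ normrM normr_sign mul1r.
rewrite ler_piMr//; apply: Cb_norm_le => // t.
have [_ ->] := eP isop; rewrite indicE.
by case: (t \in _); rewrite ?normr0 ?normr1.
Qed.

Lemma shift_sub_shift p s y z : shift p s y - shift p s z = y - z.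
Proof. by rewrite /shift opprD addrACA subrr addr0. Qed.

Lemma ball_shift B p s y : F B -> iso p.1 -> B y -> 0 <= s ->
  coord p y + s <= hi B p -> B (shift p s y).
Proof.
move=> FB isop By s0 ps; apply: ball_hiP => //.
  by apply: shift_in => //; exact: ball_sub By.
move=> q isoq; have [->|/eqP qp] := eqVneq q p; first by rewrite coord_shift.
exact: le_trans (coord_shift_le _ isop s0 qp) (ball_le_hi _ FB By).
Qed.

(** The balls that meet a ball through y are finitely many, and each of them that
    misses y is violated by y at some isolated point.  S consists of these
    points: a move along a coordinate outside S keeps all these violations. *)
Lemma shift_balls_sub y : X y -> exists2 S : set T, finite_set S &
  forall p s B, iso p.1 -> ~ S p.1 -> F B -> B y -> B (shift p s y) ->
    balls_at (shift p s y) `<=` balls_at y.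
Proof.
move=> Xy.
pose N := \bigcup_(B in balls_at y) [set C | F C /\ B `&` C !=set0].
have finN : finite_set N.
  by apply: bigcup_finite; [exact: finite_balls_at|move=> B [FB _]; apply: meetF].
pose viol C t := ~ C y -> exists b, iso t /\ hi C (t, b) < coord (t, b) y.
have [t0 iso0] : iso !=set0.
  by apply/set0P/eqP => iso0; apply: iso_infinite; rewrite iso0.
have /choice[w wP] : forall C, exists t, F C -> viol C t.
  move=> C; have [FC|] := pselect (F C); last by exists t0.
  have [Cy|nCy] := pselect (C y); first by exists t0 => _ /(_ Cy).
  apply: contrapT => nv; apply: nCy; apply: ball_hiP => // -[t b] isot.
  rewrite leNgt; apply/negP => tb; apply: nv; exists t => _ _.
  by exists b.
exists (w @` N); first exact: finite_image.
move=> p s B isop pS FB By Bz C [FC Cz]; split=> //.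
apply: contrapT => nCy; have [b [isot]] := wP C FC nCy.
suff qp : (w C, b).1 <> p.1.
  rewrite -(@coord_shift_other p _ s y isop qp) => /lt_geF.
  by rewrite ball_le_hi.
move=> /= wp; apply: pS; exists C => //.
by exists B => //; split=> //; exists (shift p s y).
Qed.

(** * Singular points *)

Definition singular y :=
  X y /\ forall d, 0 < d ->
    exists z, [/\ X z, `|z - y| < d & forall B, F B -> B y -> ~ B z].

(** C is the ball through y that reaches furthest along p.  After raising y to
    the face of C, the balls at the new point are among those at y, and all of
    these are left by any further raise. *)
Lemma singular_shift y : X y -> exists2 S : set T, finite_set S &
  forall p, iso p.1 -> ~ S p.1 -> exists C, [/\ F C, C y,
    singular (shift p (hi C p - coord p y) y) &
    balls_at (shift p (hi C p - coord p y) y) `<=` balls_at y].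
Proof.
move=> Xy; have [S finS SP] := shift_balls_sub Xy.
exists S => // p isop pS.
have [C [FC Cy] Cmax] : exists2 C, balls_at y C &
    forall B, balls_at y B -> hi B p <= hi C p.
  apply: exists_max_finite; first exact: finite_balls_at.
  by have [B FB By] := coverF Xy; exists B.
have p0 : 0 <= hi C p - coord p y by rewrite subr_ge0 ball_le_hi.
have Cz : C (shift p (hi C p - coord p y) y).
  by apply: ball_shift => //; lra.
have zsub := SP p _ C isop pS FC Cy Cz.
exists C; split => //; split; first exact: shift_in.
move=> d d0.
exists (shift p (d / 2) (shift p (hi C p - coord p y) y)); split.
- by apply: shift_in => //; exact: shift_in.
- rewrite (le_lt_trans (norm_shift_sub _ _ _))// ger0_norm; lra.
- move=> B FB Bz; have [_ By] := zsub B (conj FB Bz).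
  move=> /(ball_le_hi p FB); rewrite shiftD coord_shift//.
  by have := Cmax B (conj FB By); lra.
Qed.

Lemma exists_singular : singular !=set0.
Proof.
have [S finS SP] := singular_shift X0.
have /infinite_setN0[t [isot St]] := infinite_setD iso_infinite finS.
have [C [_ _ sC _]] := SP (t, false) isot St.
by eexists; exact: sC.
Qed.

Lemma not_singular y : X y -> ~ singular y ->
  exists2 d, 0 < d & forall z, X z -> `|z - y| < d ->
    exists B, [/\ F B, B y & B z].
Proof.
move=> Xy nsy; apply: contrapT => nd; apply: nsy; split => // d d0.
apply: contrapT => nz; apply: nd; exists d => // z Xz zy.
apply: contrapT => nB; apply: nz; exists z; split => // B FB By Bz.
by apply: nB; exists B.
Qed.

(** If the balls through x covered a neighbourhood of x, they would also cover a
    neighbourhood of every y near x; close enough to y, those missing y do not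
    contribute, so y would not be singular either. *)
Lemma closed_singular : closed singular.
Proof.
move=> x /= clx.
have near_x (d : R) : 0 < d -> exists2 y, singular y & `|y - x| < d.
  move=> d0; have [y [sy]] := clx _ (nbhsx_ballx x d d0).
  by rewrite -ball_normE /= distrC; exists y.
have Xx : X x.
  apply: X_closed => U /clx[y [[Xy _] Uy]]; by exists y.
apply: contrapT => /(not_singular Xx)[d d0 dB].
have [y sy yx] := near_x (d / 2) (divr_gt0 d0 (ltr0n _ 2)).
have [|d' d'0 d'far] := finite_balls_far y (finite_balls_at x).
  by move=> B [].
have [Xy] := sy; move=> /(_ (Order.min d' (d / 2)))[|z [Xz zy nz]].
  by rewrite lt_min d'0 divr_gt0.
move: zy; rewrite lt_min => /andP[zyd' zyd].
have [|B [FB Bx Bz]] := dB z Xz.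
  have := ler_normD (z - y) (y - x); rewrite addrA subrK; lra.
apply: (nz B FB) => //; apply: contrapT => nBy.
by have := d'far B (conj FB Bx) nBy z Bz; rewrite leNgt zyd'.
Qed.

(** * Around a singular point with minimally many balls *)

Section NearMinimalSingularPoint.
(** The condition singular_near is what minimality of x and Baire's theorem
    provide, while near_ball holds for small d, since the balls meeting a ball
    through x are finitely many and those missing x stay away from it. *)
Context (x : V) (d : R) (d_gt0 : 0 < d) (sx : singular x).
Context (singular_near : forall y B,
  singular y -> `|y - x| < d -> F B -> B x -> B y).
Context (near_ball : forall B C y, F B -> F C -> B x -> B `&` C !=set0 ->
  C y -> `|y - x| < d -> C x).

Let Xx : X x. Proof. by case: sx. Qed.

(** Otherwise raising y to the highest face along p is a move by less than d / 2
    and gives a singular point within d of x.  It lies in all balls through x.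
    As the balls through it also contain y, so does y. *)
Lemma exists_far_hi y : X y -> `|y - x| < d / 2 ->
  ~ (forall B, F B -> B x -> B y) ->
  exists2 S : set T, finite_set S & forall p, iso p.1 -> ~ S p.1 ->
    exists C, [/\ F C, C y & coord p y + d / 2 <= hi C p].
Proof.
move=> Xy yx nall; have [S finS SP] := singular_shift Xy.
exists S => // p isop pS; have [C [FC Cy sz zsub]] := SP p isop pS.
exists C; split => //; rewrite leNgt; apply/negP => Cp; apply: nall => B FB Bx.
have [//|_ //] := zsub B; split => //; apply: singular_near => //.
have := ler_normD (shift p (hi C p - coord p y) y - y) (y - x).
rewrite addrA subrK => /le_lt_trans; apply.
have := norm_shift_sub (hi C p - coord p y) y isop.
rewrite [`|hi C p - _|]ger0_norm ?subr_ge0 ?ball_le_hi//; lra.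
Qed.

(** Both faces of the interval of C along a coordinate enclose y and the upper
    one is at distance at least d / 2 from y, which bounds the radius from below.
    As C contains a point near x but misses x, it is disjoint from the balls
    through x. *)
Lemma exists_big_ball y : X y -> `|y - x| < d / 2 ->
  (forall B, F B -> B x -> ~ B y) ->
  exists C, [/\ F C, C y, d / 2 <= 2 * r C &
    forall B, F B -> B x -> exists2 p, iso p.1 & hi B p < lo C p].
Proof.
move=> Xy yx nB; have [B0 FB0 B0x] := coverF Xx.
have [|S finS SP] := exists_far_hi Xy yx.
  by move=> /(_ B0 FB0 B0x); exact: nB.
have /infinite_setN0[t [isot St]] := infinite_setD iso_infinite finS.
have [C [FC Cy far]] := SP (t, false) isot St.
exists C; split => // [|B FB Bx].
  by have := ball_ge_lo (t, false) FC Cy; move: far; rewrite /hi /lo; lra.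
apply: disjoint_balls_separated => // BC.
have yxd : `|y - x| < d by move: d_gt0 yx; lra.
by apply: (nB C FC) => //; exact: near_ball FB FC Bx BC Cy yxd.
Qed.

(** Big balls C accumulate at x and are separated from B, which forces the face
    of B along the separating coordinate p to be close to x.  The point is that p
    can be taken outside S.  For a fixed p, if big balls arbitrarily near x were
    separated from B along p, then moving by d / 4 along p keeps us inside these
    balls, so that they accumulate at x moved by d / 4.  But this point is
    outside B, hence not singular, and only finitely many balls come near it. *)
Lemma exists_near_hi B (S : set T) a : F B -> B x -> finite_set S -> 0 < a ->
  exists p, [/\ iso p.1, ~ S p.1 & hi B p < coord p x + a].
Proof.
move=> FB Bx finS a0; have d0 := d_gt0.
(* sep p m says that within m of x no big ball is separated from B along p. *)
pose sep p m := iso p.1 -> forall y C, F C -> C y -> `|y - x| < m ->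
  d / 2 <= 2 * r C -> lo C p <= hi B p.
have finP : finite_set (S `*` [set: bool]).
  by apply: finite_setX => //; exact: finite_finset.
have [p _|p m m' m'm sepm isop y C FC Cy yx|m m0 mP] :=
    finite_uniform_pos _ _ _ sep finP; last 1 first.
- have [_ /(_ (Order.min m (Order.min (d / 2) a)))[|y [Xy yx nBy]]] := sx.
    by rewrite !lt_min m0 a0 divr_gt0.
  move: yx; rewrite !lt_min => /andP[yxm /andP[yxd yxa]].
  have [C [FC Cy big Csep]] := exists_big_ball Xy yxd nBy.
  have [p isop BCp] := Csep B FB Bx.
  exists p; split => // [Sp|].
    by have := mP p (conj Sp I) isop y C FC Cy yxm big; rewrite leNgt BCp.
  have := ball_ge_lo p FC Cy; have := coord_le_norm p (y - x).
  by rewrite coordD coordN; lra.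
- have [isop|nisop] := pselect (iso p.1); last by exists 1.
  have [Bp|Bp] := ltP (coord p x) (hi B p).
    exists (hi B p - coord p x); first by rewrite subr_gt0.
    move=> _ y C FC Cy yx _; have := ball_ge_lo p FC Cy.
    by have := coord_le_norm p (y - x); rewrite coordD coordN; lra.
  have Xx' : X (shift p (d / 4) x) by exact: shift_in.
  have [|m m0 mP] := not_singular Xx'.
    move=> /singular_near/(_ _ FB Bx) Bx'.
    have /Bx' : `|shift p (d / 4) x - x| < d.
      rewrite (le_lt_trans (norm_shift_sub _ _ isop))// ger0_norm; lra.
    by move=> /(ball_le_hi p FB); rewrite coord_shift//; lra.
  pose N := \bigcup_(C in balls_at (shift p (d / 4) x))
    [set C' | F C' /\ C `&` C' !=set0].
  have [|C [C' _ []]//|m' m'0 farN] := @finite_balls_far N x.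
    by apply: bigcup_finite => [|C [FC _]]; [exact: finite_balls_at|apply: meetF].
  exists (Order.min (d / 4) (Order.min m m')).
    by rewrite !lt_min m0 m'0 divr_gt0.
  move=> _ y C FC Cy; rewrite !lt_min => /and3P[yxd yxm yxm'] big.
  rewrite leNgt; apply/negP => BCp.
  have Bpx := ball_le_hi p FB Bx.
  have ypx := coord_le_norm p (y - x); rewrite coordD coordN in ypx.
  have Cz : C (shift p (d / 4) y).
    apply: ball_shift => //; first by rewrite divr_ge0// ltW.
    by move: BCp big; rewrite /lo /hi in Bp Bpx *; lra.
  have [||B' [FB' B'x' B'z]] := mP (shift p (d / 4) y).
  - exact: ball_sub Cz.
  - by rewrite shift_sub_shift.
  have nCx : ~ C x by move=> /(ball_ge_lo p FC); lra.
  have NC : N C.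
    by exists B' => //; split => //; exists (shift p (d / 4) y).
  by have := farN C NC nCx y Cy; rewrite leNgt yxm'.
- by apply: (sepm isop y C FC Cy); exact: lt_le_trans m'm.
Qed.

(** Suppose that no ball through x reaches beyond B along p.  Points of the line
    through x along p just beyond the face of B then lie in big balls disjoint
    from B, necessarily separated from B along p, since in the other coordinates
    the points satisfy the conditions defining B.  All these big balls contain
    the point q at distance d / 4 beyond the face.  Only finitely many balls
    contain q, so those separated from B along p leave a gap of some width m
    beyond B, contradicting the choice of a point at distance s < m. *)
Lemma exists_higher_ball B p : F B -> B x -> iso p.1 ->
  hi B p < coord p x + d / 4 ->
  exists C, [/\ F C, C x & hi B p < hi C p].
Proof.
move=> FB Bx isop near_hi; have d0 := d_gt0; apply: contrapT => nC.
have Bmax C : F C -> C x -> hi C p <= hi B p.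
  by move=> FC Cx; rewrite leNgt; apply/negP => ?; apply: nC; exists C.
have Bpx := ball_le_hi p FB Bx.
pose q := shift p (hi B p - coord p x + d / 4) x.
have [C _|C m m' m'm mP BC|m m0 mP] := finite_uniform_pos _ _ _
    (fun C m => hi B p < lo C p -> hi B p + m <= lo C p) (finite_balls_at q).
- have [BC|CB] := ltP (hi B p) (lo C p); last by exists 1.
  by exists (lo C p - hi B p) => [|_]; [rewrite subr_gt0|rewrite addrC subrK].
- by apply: le_trans (mP BC); rewrite lerD2l.
pose s := Order.min m (d / 4) / 2.
have [s0 sm sd] : [/\ 0 < s, s < m & s < d / 4].
  have k0 : 0 < Order.min m (d / 4) by rewrite lt_min m0 divr_gt0.
  have : Order.min m (d / 4) <= m by rewrite ge_min lexx.
  have : Order.min m (d / 4) <= d / 4 by rewrite ge_min lexx orbT.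
  by rewrite /s; split; lra.
pose y := shift p (hi B p - coord p x + s) x.
have py : coord p y = hi B p + s by rewrite coord_shift//; lra.
have Xy : X y by exact: shift_in.
have [|C FC Cx /(ball_le_hi p FC)|C [FC Cy big Csep]] := exists_big_ball Xy.
- by rewrite (le_lt_trans (norm_shift_sub _ _ isop))// ger0_norm; lra.
- by have := Bmax C FC Cx; lra.
have [p' isop' BCp'] := Csep B FB Bx.
have pp' : p' = p.
  apply: contrapT => p'p.
  have := ball_ge_lo p' FC Cy; have := ball_le_hi p' FB Bx.
  have : coord p' y <= coord p' x by apply: coord_shift_le => //; lra.
  by lra.
rewrite {p' isop'}pp' in BCp'.
have Cpy := ball_ge_lo p FC Cy.
have Cq : C q.
  have -> : q = shift p (d / 4 - s) y by rewrite shiftD /q; congr shift; ring.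
  apply: ball_shift => //; first by lra.
  by rewrite py; move: BCp' Cpy big; rewrite py /lo /hi; lra.
by have := mP C (conj FC Cq) BCp'; lra.
Qed.

(** A move along p to a height v strictly above the face of B and not above that
    of C gives a point z outside B whose balls are among those of y, which
    contradicts the minimality of y. *)
Lemma no_minimal_singular_point : False.
Proof.
have d0 := d_gt0.
pose Y y := [/\ X y, `|y - x| <= d / 4 & exists B, [/\ F B, B x & B y]].
have [|y [Xy yx [B [FB Bx By]]] ymin] :=
    exists_min_finite _ _ Y balls_at _ finite_balls_at.
  exists x; split => //; first by rewrite subrr normr0 divr_ge0// ltW.
  by have [B FB Bx] := coverF Xx; exists B.
have [S finS SP] := shift_balls_sub Xy.
(* If y lies in all the balls through x, the higher ball comes from x; otherwise
   a face far above y does, as the face of B is within d / 4 above x. *)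
have [S' finS' S'P] : exists2 S' : set T, finite_set S' & forall p, iso p.1 ->
    ~ S' p.1 -> hi B p < coord p x + d / 4 ->
    exists C, [/\ F C, C y & hi B p < hi C p].
  have [yall|nall] := pselect (forall C, F C -> C x -> C y).
    exists set0 => // p isop _ /(exists_higher_ball FB Bx isop)[C [FC Cx BC]].
    by exists C; split => //; exact: yall.
  have [|S' finS' S'P] := exists_far_hi Xy _ nall; first by lra.
  exists S' => // p isop pS' Bp; have [C [FC Cy Cp]] := S'P p isop pS'.
  exists C; split => //; have := coord_le_norm p (x - y).
  by rewrite distrC coordD coordN; lra.
have finSS : finite_set (S `|` S') by rewrite finite_setU.
have [p [isop pSS Bp]] :=
  exists_near_hi FB Bx finSS (divr_gt0 d0 (ltr0n R 4)).
have [pS pS'] : ~ S p.1 /\ ~ S' p.1.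
  by split => ?; apply: pSS; [left|right].
have [C [FC Cy BC]] := S'P p isop pS' Bp.
pose v := Order.min (hi C p) (coord p x + d / 4).
have [vB vC vx] : [/\ hi B p < v, v <= hi C p & v <= coord p x + d / 4].
  by rewrite /v lt_min BC Bp !ge_min !lexx orbT.
have yB := ball_le_hi p FB By.
pose z := shift p (v - coord p y) y.
have zv : coord p z = v by rewrite coord_shift//; lra.
have Cz : C z by apply: ball_shift => //; lra.
have Cx : C x.
  apply: (near_ball FB FC Bx _ Cy); last by lra.
  by exists y.
have xy_le q : coord q y - coord q x <= d / 4.
  by rewrite -coordN -coordD (le_trans (coord_le_norm _ _)).
have Yz : Y z.
  split; first exact: shift_in; last by exists C.
  apply: norm_le_coord => // [|q isoq]; first by rewrite divr_ge0// ltW.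
  rewrite coordD coordN; have [->|/eqP qp] := eqVneq q p; first by lra.
  have : coord q z <= coord q y by apply: coord_shift_le => //; lra.
  by have := xy_le q; lra.
have zy := SP p _ C isop pS FC Cy Cz.
have [_ /(ball_le_hi p FB)] := ymin z Yz zy B (conj FB By).
by rewrite zv; lra.
Qed.

End NearMinimalSingularPoint.

(** It remains to find a point x as in the previous section.  Baire's theorem
    gives a ball B0 containing all singular points near x0; among these x has
    minimally many balls.  A singular y near x lies in B0, so the balls through y
    meet a ball through x and thus contain x when d is small; by minimality, the
    balls at y and at x are the same. *)
Lemma star_finite_covering_uncountable : ~ countable F.
Proof.
move=> countF.
have singular_cover : singular `<=` \bigcup_(B in F) B.
  by move=> y [/coverF[B FB By] _]; exists B.
have [B0 [x0 [d0 [FB0 sx0 d0_gt0 B0P]]]] :=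
  closed_baire _ _ _ _ closed_singular exists_singular countF ball_closed
    singular_cover.
pose Y y := singular y /\ `|y - x0| < d0.
have [|x [sx xx0] xmin] :=
    exists_min_finite _ _ Y balls_at _ finite_balls_at.
  by exists x0; split => //; rewrite subrr normr0.
have B0x : B0 x by exact: B0P.
pose N := \bigcup_(C in balls_at x) [set C' | F C' /\ C `&` C' !=set0].
have [|C [C' _ []]//|d1 d1_gt0 farN] := @finite_balls_far N x.
  by apply: bigcup_finite => [|C [FC _]]; [exact: finite_balls_at|apply: meetF].
have near_ball d B C y : d <= d1 -> F B -> F C -> B x -> B `&` C !=set0 ->
    C y -> `|y - x| < d -> C x.
  move=> dd1 FB FC Bx BC Cy yx; apply: contrapT => nCx.
  have NC : N C by exists B.
  by have := farN C NC nCx y Cy; rewrite leNgt (lt_le_trans yx dd1).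
pose d := Order.min d1 (d0 - `|x - x0|).
have [d_gt0 dd1 dd0] : [/\ 0 < d, d <= d1 & d <= d0 - `|x - x0|].
  by rewrite /d lt_min subr_gt0 d1_gt0 xx0 !ge_min !lexx orbT.
apply: (@no_minimal_singular_point x d d_gt0 sx) => [y B sy yx FB Bx|].
  have Yy : Y y.
    split => //; have := ler_normD (y - x) (x - x0).
    by rewrite addrA subrK; lra.
  have B0y : B0 y by case: Yy; exact: B0P.
  have yx_balls : balls_at y `<=` balls_at x.
    move=> C [FC Cy]; split => //.
    by apply: (near_ball d B0 C y) => //; exists y.
  by have [] := xmin y Yy yx_balls B (conj FB Bx).
by move=> B C y; exact: near_ball.
Qed.

End StarFiniteCovering.

Theorem theorem3p14 (R : realType) (T : topologicalType)
    (T_infinite : infinite_set [set: T])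
    (T_hausdorff : hausdorff_space T)
    (T_isolated : dense (isolated [set: T]))
    (X : set (Cb T R))
    (X_submod : submod_closed (mem X))
    (X_closed : closed X)
    (X_indic : forall t : T, isolated [set: T] t ->
      exists2 f : Cb T R, X f & (f : T -> R) = \1_[set t]) :
  ~ exists F : set (set (Cb T R)),
      [/\ F `<=` closed_balls X, covering X F, countable F & star_finite F].
Proof.
move=> [F [F_balls [F_ne F_cover] F_countable F_star]].
(* A finite set of isolated points would be closed, hence all of T by density. *)
have iso_infinite : infinite_set (isolated [set: T]).
  move=> iso_finite; apply: T_infinite.
  have clI : closed (isolated [set: T]).
    by apply: (accessible_finite_set_closed.1 (hausdorff_accessible T_hausdorff)).
  suff -> : [set: T] = isolated [set: T] by [].
  apply/seteqP; split => // t _; apply: contrapT => nt.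
  have [s [/= ns /ns]] := T_isolated (~` isolated [set: T]) (ex_intro _ t nt)
    (closed_openC clI).
  by [].
have [X0 Xlin] := X_submod.
have /choice[e eP] : forall t, exists f : Cb T R, isolated [set: T] t ->
    X f /\ (f : T -> R) = \1_[set t].
  move=> t; have [/X_indic[f Xf fE]|nt] := pselect (isolated [set: T] t).
    by exists f.
  by exists 0.
have /choice[cr crP] : forall B, exists cr : Cb T R * R, F B ->
    [/\ X cr.1, 0 < cr.2 &
      B = closed_ball_ (fun y : Cb T R => `|y|) cr.1 cr.2 `&` X].
  move=> B; have [/F_balls[c [r cr]]|nB] := pselect (F B); last by exists (0, 0).
  by exists (c, r).
apply: (@star_finite_covering_uncountable R T iso_infinite T_isolated X X_closed
  _ _ e eP F (fun B => (cr B).1) (fun B => (cr B).2) crP _ _ F_countable).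
- by move: X0; rewrite inE.
- by move=> a y z Xy Xz; have := Xlin a y z; rewrite !inE; exact.
- by move=> y; rewrite -F_cover => -[B FB By]; exists B.
- move=> B FB; have finB : finite_set ([set B] `|`
      [set C | [/\ F C, C <> B & B `&` C !=set0]]).
    by rewrite finite_setU; split; [exact: finite_set1|exact: F_star].
  apply: sub_finite_set finB => C [FC BC].
  by have [->|CB] := pselect (C = B); [left|right].
Qed.
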